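(* Let $B$ be a complete Boolean algebra. The space $(B,\tau_s)$ is Fréchet if and only if $B$ is weakly distributive and satisfies the $\mathbf b$-chain condition.
   Context: For a sequence $\langle b_n\rangle$ in a complete Boolean algebra $B$, let $\overline{\lim}\, b_n=\bigwedge_k\bigvee_{n\ge k}b_n$ and $\underline{\lim}\, b_n=\bigvee_k\bigwedge_{n\ge k}b_n$; the sequence algebraically converges to $b$ if both equal $b$. The sequential topology $\tau_s$ on $B$ is the largest topology on $B$ in which every algebraically convergent sequence converges to its algebraic limit. A topological space is Fréchet if for every subset $A$, the closure of $A$ equals the set of limits of sequences of elements of $A$. $B$ is weakly distributive if for every sequence $\{P_n\}$ of countable maximal antichains there is a set $Q$ that is dense (every nonzero $b$ has a nonzero $q\in Q$ with $q\le b$) such that each $q\in Q$ meets (has nonzero meet with) only finitely many elements of each $P_n$. $\mathbf b$ is the bounding number: the least size of a family $\mathcal F\subseteq\omega^\omega$ such that for every $g\in\omega^\omega$ some $f\in\mathcal F$ has $g(n)\le f(n)$ for infinitely many $n$. $B$ satisfies the $\mathbf b$-chain condition if every antichain in $B$ has size less than $\mathbf b$. *)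

(* Defs.v *)
From HB Require Import structures.
From mathcomp Require Import all_boot all_order.
From mathcomp Require Import boolp classical_sets functions cardinality.
From mathcomp Require Import filter topology.

Set Implicit Arguments.
Unset Strict Implicit.
Unset Printing Implicit Defensive.

Import Order.TTheory.

Local Open Scope classical_set_scope.
Local Open Scope card_scope.
Local Open Scope order_scope.

Definition complete_boolean_algebra d (B : ctbDistrLatticeType d) : Prop :=
  forall A : set B, supremums A !=set0 /\ infimums A !=set0.

Section AlgebraicConvergence.
Context {d : Order.disp_t} {B : ctbDistrLatticeType d}.
Implicit Types (A : set B) (u : nat -> B).

Definition bigjoin A : B := supremum \bot A.
Definition bigmeet A : B := infimum \top A.

Definition alg_limsup u : B :=
  bigmeet [set bigjoin [set u n | n in [set n | (k <= n)%N]] | k in [set: nat]].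
Definition alg_liminf u : B :=
  bigjoin [set bigmeet [set u n | n in [set n | (k <= n)%N]] | k in [set: nat]].

Definition alg_cvg u (b : B) : Prop := alg_limsup u = b /\ alg_liminf u = b.

End AlgebraicConvergence.

Definition is_topology (T : Type) (O : set (set T)) : Prop :=
  [/\ O setT,
      forall U V, O U -> O V -> O (U `&` V)%classic
    & forall F : set (set T), F `<=` O -> O (\bigcup_(U in F) U)].

Section SequentialTopology.
Context {d : Order.disp_t} (B : ctbDistrLatticeType d).
Implicit Types (O : set (set B)) (U : set B).

Definition alg_cvg_in O : Prop :=
  forall (u : nat -> B) (b : B), alg_cvg u b ->
    forall U, O U -> U b -> \forall n \near \oo, U (u n).

(* The union of all topologies in which algebraic convergence implies
   convergence; [tau_s_largest] shows that it is itself such a topology, hence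
   the largest one. *)
Definition tau_s : set (set B) :=
  \bigcup_(O in [set O | is_topology O /\ alg_cvg_in O]) O.

Let seq_open : set (set B) := [set U | forall (u : nat -> B) (b : B),
  alg_cvg u b -> U b -> \forall n \near \oo, U (u n)].

Let seq_open_topology : is_topology seq_open.
Proof.
split=> [u b _ _|U V oU oV u b ub [Ub Vb]|F FO u b ub [U FU Ub]].
- exact: nearW.
- by apply: filterI; [exact: oU ub Ub|exact: oV ub Vb].
- by apply: filterS (FO _ FU _ _ ub Ub) => n Un; exists U.
Qed.

Let tau_sE : tau_s = seq_open.
Proof.
apply/seteqP; split=> [U [O [_ cO] OU] u b ub|U oU]; first exact: (cO _ _ ub).
exists seq_open => //; split; first exact: seq_open_topology.
by move=> u b ub V; apply.
Qed.

Lemma tau_s_topology : is_topology tau_s.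
Proof. by rewrite tau_sE; exact: seq_open_topology. Qed.

Lemma tau_s_largest :
  [/\ is_topology tau_s, alg_cvg_in tau_s
    & forall O, is_topology O -> alg_cvg_in O -> O `<=` tau_s].
Proof.
split; first exact: tau_s_topology.
- by rewrite tau_sE => u b ub U; apply.
- by move=> O tO cO U OU; exists O.
Qed.

(* A copy of B that carries the topology tau_s. *)
Definition seq_space : Type := B.
HB.instance Definition _ := Choice.on seq_space.

Let tau_sT : tau_s setT. Proof. by case: tau_s_topology. Qed.

Let tau_sI : setI_closed tau_s. Proof. by case: tau_s_topology. Qed.

Let tau_s_bigcup (I : Type) (f : I -> set B) :
  (forall i, tau_s (f i)) -> tau_s (\bigcup_i f i).
Proof.
move=> of_; have [_ _ /(_ (range f))] := tau_s_topology.
by rewrite bigcup_image; apply=> _ [i _ <-].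
Qed.

HB.instance Definition _ := @isOpenTopological.Build seq_space
  tau_s tau_sT tau_sI tau_s_bigcup.

Lemma open_seq_spaceE : @open seq_space = tau_s.
Proof. by []. Qed.

End SequentialTopology.

Definition frechet_space (T : topologicalType) : Prop :=
  forall A : set T, closure A =
    [set x | exists2 u : nat -> T, (forall n, A (u n)) & u @ \oo --> x].

Section ChainConditions.
Context {d : Order.disp_t} (B : ctbDistrLatticeType d).

Definition antichain (A : set B) : Prop :=
  (forall a, A a -> a != \bot) /\
  (forall a b, A a -> A b -> a != b -> a `&` b = \bot).

Definition maximal_antichain (A : set B) : Prop :=
  antichain A /\ forall A', antichain A' -> A `<=` A' -> A' = A.

Definition dense_subset (Q : set B) : Prop :=
  forall b : B, b != \bot -> exists q, [/\ Q q, q != \bot & q <= b].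

Definition weakly_distributive : Prop :=
  forall P : nat -> set B,
    (forall n, maximal_antichain (P n) /\ countable (P n)) ->
    exists2 Q : set B, dense_subset Q &
      forall q, Q q -> forall n, finite_set [set p | P n p /\ q `&` p != \bot].

End ChainConditions.

Lemma least_card (T : pointedType) (C : set (set T)) : C !=set0 ->
  exists2 F, C F & forall G, C G -> F #<= G.
Proof.
move=> [F0 CF0].
(* A maximal set of choice functions on C, pairwise distinct at every member
   of C, must exhaust some F in C; that F injects into all others. *)
pose P (S : set (set T -> T)) :=
  (forall h, S h -> forall F, C F -> F (h F)) /\
  (forall h k, S h -> S k -> forall F, C F -> h F = k F -> h = k).
have [|S [[SC Sinj] Smax]] := @Zorn_bigcup _ P.
  move=> K KP Ktot; split=> [h [S KS Sh]|h k [S KS Sh] [S' KS' S'k]].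
    by have [+ _] := KP _ KS; apply.
  have [SS'|S'S] := Ktot _ _ KS KS'.
    by have [_] := KP _ KS'; apply=> //; exact: SS'.
  by have [_] := KP _ KS; apply=> //; exact: S'S.
have [F CF FS] : exists2 F, C F & forall x, F x -> exists2 h, S h & h F = x.
  apply: contrapT => nF.
  have ex F : exists x, C F -> F x /\ forall h, S h -> h F <> x.
    have [CF|] := pselect (C F); last by exists point.
    apply: contrapT => nx; apply: nF; exists F => // x Fx.
    apply: contrapT => nh; apply: nx; exists x => _; split=> // h Sh hx.
    by apply: nh; exists h.
  have [h0 h0P] := choice ex.
  have nSh0 : ~ S h0 by move=> /((h0P _ CF0).2).
  apply: (Smax (S `|` [set h0])%classic).
    by split=> [h Sh|/(_ h0)]; [left|apply: contra_not nSh0; apply; right].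
  split=> [h [Sh|->] F CF|h k [Sh|->] [Sk|->] F CF //].
  - exact: (SC _ Sh _ CF).
  - exact: (h0P _ CF).1.
  - exact: (Sinj _ _ Sh Sk _ CF).
  - by move=> /((h0P _ CF).2 _ Sh).
  - by move=> /esym/((h0P _ CF).2 _ Sk).
exists F => // G CG.
have ex x : exists h, F x -> S h /\ h F = x.
  have [/FS[h Sh hx]|] := pselect (F x); last by exists (fun=> point).
  by exists h.
have [e eP] := choice ex.
have Fe : (fun x => e x G) @` F #= F.
  apply: inj_card_eq => x y /set_mem Fx /set_mem Fy /= exy.
  have [Sx <-] := eP _ Fx; have [Sy yF] := eP _ Fy.
  by rewrite -[RHS]yF (Sinj _ _ Sx Sy G CG exy).
rewrite -(card_le_eql Fe); apply: subset_card_le => _ [x Fx <-].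
exact: (SC _ (eP _ Fx).1 _ CG).
Qed.

Definition unbounded_family (F : set (nat -> nat)) : Prop :=
  forall g : nat -> nat, exists2 f, F f &
    infinite_set [set n | (g n <= f n)%N].

(* [F] is an unbounded family of least size, i.e. the cardinality of [F] is the
   bounding number. *)
Definition has_card_b (F : set (nat -> nat)) : Prop :=
  unbounded_family F /\ forall G, unbounded_family G -> F #<= G.

Lemma has_card_b_ex : exists F, has_card_b F.
Proof.
have [|F uF Fmin] := @least_card _ unbounded_family; last by exists F.
exists setT => g; exists g => //.
rewrite (_ : [set _ | _] = setT); first exact: infinite_nat.
by apply/seteqP; split=> n //= _; exact: leqnn.
Qed.

Definition card_lt_b (T : Type) (A : set T) : Prop :=
  exists2 F, has_card_b F & (A #<= F) && ~~ (F #<= A).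

Definition b_chain_condition d (B : ctbDistrLatticeType d) : Prop :=
  forall A : set B, antichain A -> card_lt_b A.

(* Main.v *)
Require Import Defs.
From mathcomp Require Import all_boot all_order.
From mathcomp Require Import boolp classical_sets functions cardinality.
From mathcomp Require Import filter topology.

(** Order convergence to [b] is domination of the symmetric difference with [b]
    by a sequence decreasing to [\bot].  Both sides of the theorem amount to a
    diagonal property: if each row [y n] decreases to [\bot], some choice
    [y n (g n)] is dominated by a sequence decreasing to [\bot].

    The property says that algebraic limits of algebraic limits are algebraic
    limits, which is what the Fréchet property means once topologically
    convergent sequences are known to have algebraically convergent
    subsequences.

    Given weak distributivity, densely many [q] satisfy [q `&` y n (f n) = \bot]
    for all [n], for some [f] depending on [q]; a maximal antichain of such [q]
    is smaller than the bounding number, so one [g] eventually dominates all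
    these [f], and [y n (g n)] tends to [\bot].  Conversely, joins of tails of
    antichains indexed by [nat], resp. by an unbounded family of functions, are
    rows to which the diagonal property applies, giving weak distributivity,
    resp. the chain condition. *)

Set Implicit Arguments.
Unset Strict Implicit.
Unset Printing Implicit Defensive.

Import Order.Theory.

Local Open Scope classical_set_scope.
Local Open Scope card_scope.
Local Open Scope order_scope.

(** * Comparability of cardinals and infinite sets of naturals *)

(** Zorn on graphs of partial injections: a maximal one has full domain or full range, since
    otherwise a pair could be added. *)
Lemma card_le_total (T U : Type) (A : set T) (B : set U) : A #<= B \/ B #<= A.
Proof.
pose P (G : set (T * U)) := [/\ forall x, G x -> A x.1 /\ B x.2,
  forall x y, G x -> G y -> x.1 = y.1 -> x = y &
  forall x y, G x -> G y -> x.2 = y.2 -> x = y].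
have [|G [[GAB G1 G2] Gmax]] := @Zorn_bigcup _ P.
  move=> K KP Ktot; split=> [x [G KG]|x y [G KG Gx] [H KH Hy]|
      x y [G KG Gx] [H KH Hy]]; first by have [+ _ _] := KP _ KG; apply.
  - have [GH|HG] := Ktot _ _ KG KH.
      by have [_ + _] := KP _ KH; apply=> //; exact: GH.
    by have [_ + _] := KP _ KG; apply=> //; exact: HG.
  - have [GH|HG] := Ktot _ _ KG KH.
      by have [_ _] := KP _ KH; apply=> //; exact: GH.
    by have [_ _] := KP _ KG; apply=> //; exact: HG.
have G1c : fst @` G #= G.
  by apply: inj_card_eq => x y /set_mem Gx /set_mem Gy; exact: G1.
have G2c : snd @` G #= G.
  by apply: inj_card_eq => x y /set_mem Gx /set_mem Gy; exact: G2.
have GA : fst @` G `<=` A by move=> _ [x /GAB[Ax _] <-].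
have GB : snd @` G `<=` B by move=> _ [x /GAB[_ Bx] <-].
have [AG|/existsNP[a /not_implyP[Aa nGa]]] := pselect (A `<=` fst @` G).
  left; apply: card_le_trans (subset_card_le GB).
  by rewrite (card_le_eqr G2c) -(card_le_eqr G1c); exact: subset_card_le.
have [BG|/existsNP[b /not_implyP[Bb nGb]]] := pselect (B `<=` snd @` G).
  right; apply: card_le_trans (subset_card_le GA).
  by rewrite (card_le_eqr G1c) -(card_le_eqr G2c); exact: subset_card_le.
exfalso; apply: (Gmax (G `|` [set (a, b)])%classic).
  split=> [x Gx|/(_ (a, b))/(_ (or_intror erefl)) Gab]; first by left.
  by apply: nGa; exists (a, b).
split=> [x [/GAB//|->//]|x y [Gx|->] [Gy|->] //=|x y [Gx|->] [Gy|->] //=].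
- exact: G1.
- by move=> xa; exfalso; apply: nGa; exists x.
- by move=> ya; exfalso; apply: nGa; exists y.
- exact: G2.
- by move=> xb; exfalso; apply: nGb; exists x.
- by move=> yb; exfalso; apply: nGb; exists y.
Qed.

Lemma not_near_infty (P : set nat) : ~ (\forall n \near \oo, P n) ->
  exists phi : nat -> nat, forall n, (n <= phi n)%N /\ ~ P (phi n).
Proof.
move=> nP.
suff /choice[phi] : forall n, exists m, (n <= m)%N /\ ~ P m by exists phi.
move=> n; apply: contrapT => nn; apply: nP; exists n => // m nm.
by apply: contrapT => nPm; apply: nn; exists m.
Qed.

Lemma finite_set_nat_lt (A : set nat) :
  finite_set A -> exists N, forall n, A n -> (n < N)%N.
Proof.
move=> /finite_seqP[s ->]; exists (\max_(i <- s) i).+1%N => n /= ns.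
by rewrite ltnS; exact: (leq_bigmax_seq (F := id)) ns _.
Qed.

(** * Joins, meets and sequences decreasing to [\bot] *)

Section Convergence.
Context {d : Order.disp_t} {B : ctbDistrLatticeType d}.
Context (hB : complete_boolean_algebra B).
Implicit Types (A : set B) (u v z : nat -> B) (b c x : B).

Lemma bigjoin_ub A x : A x -> x <= bigjoin A.
Proof.
move=> Ax; rewrite /bigjoin /supremum; case: ifPn => [/eqP A0|_].
  by move: Ax; rewrite A0.
by have [+ _] := xgetPex \bot (hB A).1; apply.
Qed.

Lemma bigjoin_le A b : (forall x, A x -> x <= b) -> bigjoin A <= b.
Proof.
move=> Ab; rewrite /bigjoin /supremum; case: ifPn => [_|_]; first exact: le0x.
by have [_ +] := xgetPex \bot (hB A).1; apply.
Qed.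

Lemma bigmeet_lb A x : A x -> bigmeet A <= x.
Proof.
move=> Ax; rewrite /bigmeet /infimum; case: ifPn => [/eqP A0|_].
  by move: Ax; rewrite A0.
by have [+ _] := xgetPex \top (hB A).2; apply.
Qed.

Lemma bigmeet_ge A b : (forall x, A x -> b <= x) -> b <= bigmeet A.
Proof.
move=> Ab; rewrite /bigmeet /infimum; case: ifPn => [_|_]; first exact: lex1.
by have [_ +] := xgetPex \top (hB A).2; apply.
Qed.

Lemma bigjoin_disjoint A c :
  (forall x, A x -> x `&` c = \bot) -> bigjoin A `&` c = \bot.
Proof.
move=> Ac; apply/eqP; rewrite Order.CTBDistrLatticeTheory.disj_leC.
by apply: bigjoin_le => x Ax; rewrite -Order.CTBDistrLatticeTheory.disj_leC Ac.
Qed.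

Definition down0 z : Prop :=
  (forall n, z n.+1 <= z n) /\ (forall c, (forall n, c <= z n) -> c = \bot).

Lemma down0_le z m n : down0 z -> (m <= n)%N -> z n <= z m.
Proof.
move=> [zS _] /subnK <-; elim: (n - m)%N => [//|k IH].
by rewrite addSn; exact: le_trans (zS _) IH.
Qed.

Lemma down0_join z z' : down0 z -> down0 z' -> down0 (fun n => z n `|` z' n).
Proof.
move=> dz dz'; split=> [n|c cz]; first by rewrite leU2 ?dz.1 ?dz'.1.
(* Monotonicity at index [maxn k n] gives [c <= z k]|[z' n], so [c] minus [z k] is a lower bound of
   [z']. *)
apply: dz.2 => k; rewrite -diff_eq0; apply/eqP; apply: dz'.2 => n.
rewrite leBLR; apply: le_trans (cz (maxn k n)) _.
by apply: leU2; apply: down0_le => //; rewrite ?leq_maxl ?leq_maxr.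
Qed.

Lemma down0_cst0 : down0 (fun=> \bot).
Proof. by split=> // c /(_ 0%N); rewrite lex0 => /eqP. Qed.

Lemma down0_joins (y : nat -> nat -> B) n : (forall i, down0 (y i)) ->
  down0 (fun m => \join_(i < n) y i m).
Proof.
move=> dy; elim: n => [|n IH].
  by under eq_fun do rewrite big_ord0; exact: down0_cst0.
by under eq_fun do rewrite big_ord_recr /=; exact: down0_join.
Qed.

(** * Order convergence *)

Definition order_cvg u b : Prop :=
  exists2 z, down0 z & forall n, u n <= b `|` z n /\ b <= u n `|` z n.

(** The error at [k] is the tail join minus [b], joined with [b] minus the tail meet. Conversely, an
    error decreasing to [\bot] forces limsup below [b] and [b] below liminf, while liminf is always
    below limsup. *)
Lemma alg_cvgP u b : alg_cvg u b <-> order_cvg u b.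
Proof.
have ge_sup k n : (k <= n)%N ->
    u n <= bigjoin [set u n | n in [set n | (k <= n)%N]].
  by move=> kn; apply: bigjoin_ub; exists n.
have inf_le k n : (k <= n)%N ->
    bigmeet [set u n | n in [set n | (k <= n)%N]] <= u n.
  by move=> kn; apply: bigmeet_lb; exists n.
split=> [[us ui]|[z dz uz]].
  exists (fun k => (bigjoin [set u n | n in [set n | (k <= n)%N]] `\` b) `|`
                   (b `\` bigmeet [set u n | n in [set n | (k <= n)%N]])).
    apply: (@down0_join (fun k => _ `\` b) (fun k => b `\` _)).
      split=> [k|c cz].
        apply: leBl; apply: bigjoin_le => _ [n /= kn <-].
        by apply: ge_sup; exact: ltnW.
      have cb : c `&` b = \bot.
        by have := cz 0%N; rewrite leBRL => /andP[_ /eqP].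
      have {us} : c <= b.
        rewrite -us; apply: bigmeet_ge => _ [k _ <-].
        by have := cz k; rewrite leBRL => /andP[].
      by move=> /meet_idPl; rewrite cb.
    split=> [k|c cz].
      apply: leBr; apply: bigmeet_ge => _ [n /= kn <-].
      by apply: inf_le; exact: ltnW.
    have cb : c <= b by have := cz 0%N; rewrite leBRL => /andP[].
    have : b `&` c = \bot.
      rewrite -ui; apply: bigjoin_disjoint => _ [k _ <-].
      by have := cz k; rewrite leBRL meetC => /andP[_ /eqP].
    by rewrite meetC (meet_idPl cb).
  move=> n; split.
    rewrite joinA diffKU; apply: le_trans (ge_sup n n (leqnn n)) _.
    exact: le_trans (leUr _ _) (leUl _ _).
  rewrite -leBLR; apply: le_trans (leUr _ _).
  by apply: leBr; exact: inf_le.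
have sup_le : alg_limsup u <= b.
  rewrite -diff_eq0; apply/eqP; apply: dz.2 => k; rewrite leBLR.
  apply: (@le_trans _ _ (bigjoin [set u n | n in [set n | (k <= n)%N]])).
    by apply: bigmeet_lb; exists k.
  apply: bigjoin_le => _ [n /= kn <-].
  by apply: le_trans (uz n).1 _; apply: leU2 => //; exact: down0_le.
have inf_ge : b <= alg_liminf u.
  rewrite -diff_eq0; apply/eqP; apply: dz.2 => k; rewrite leBLR joinC -leBLR.
  apply: (@le_trans _ _ (bigmeet [set u n | n in [set n | (k <= n)%N]])).
    apply: bigmeet_ge => _ [n /= kn <-]; rewrite leBLR joinC.
    by apply: le_trans (uz n).2 _; apply: leU2 => //; exact: down0_le.
  by apply: bigjoin_ub; exists k.
have inf_sup : alg_liminf u <= alg_limsup u.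
  apply: bigjoin_le => _ [k _ <-]; apply: bigmeet_ge => _ [l _ <-].
  exact: le_trans (inf_le _ _ (leq_maxl k l)) (ge_sup _ _ (leq_maxr k l)).
split; apply/eqP; rewrite eq_le.
  by rewrite sup_le (le_trans inf_ge).
by rewrite inf_ge (le_trans inf_sup).
Qed.

(** As errors decrease, [n <= phi n] suffices; index maps need not be monotone here or below. *)
Lemma order_cvg_subseq u b (phi : nat -> nat) :
  (forall n, (n <= phi n)%N) -> order_cvg u b -> order_cvg (u \o phi) b.
Proof.
move=> phin [z dz uz]; exists z => // n /=.
have [ub bu] := uz (phi n); have zz : z (phi n) <= z n by exact: down0_le.
by split; [apply: le_trans ub _|apply: le_trans bu _]; exact: leU2.
Qed.

Lemma order_cvg_cst b : order_cvg (fun=> b) b.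
Proof. by exists (fun=> \bot); [exact: down0_cst0|move=> n; rewrite leUl]. Qed.

Lemma order_cvg_unique u b c : order_cvg u b -> order_cvg u c -> b = c.
Proof. by move=> /alg_cvgP[<- _] /alg_cvgP[<- _]. Qed.

Lemma order_cvg_frequently (P : set B) u b : order_cvg u b ->
  ~ (\forall n \near \oo, ~ P (u n)) ->
  exists2 v, (forall n, P (v n)) & order_cvg v b.
Proof.
move=> ub /not_near_infty[phi phiP]; exists (u \o phi) => [n|].
  apply: contrapT; exact: (phiP n).2.
by apply: order_cvg_subseq ub => n; exact: (phiP n).1.
Qed.

(** * Closed sets and convergent sequences of [tau_s] *)

Definition seq_closed (C : set B) : Prop :=
  forall u b, (forall n, C (u n)) -> order_cvg u b -> C b.

(** Sequentially open sets form a topology [O] in which algebraic convergence implies convergence,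
    so the largest such topology contains [O]. *)
Lemma seq_open_tau_s (U : set B) :
  (forall u b, order_cvg u b -> U b -> \forall n \near \oo, U (u n)) ->
  tau_s U.
Proof.
move=> oU; pose O := [set V : set B | forall u b, alg_cvg u b -> V b ->
  \forall n \near \oo, V (u n)].
have [_ _ /(_ O)] := tau_s_largest B; apply.
- split=> [u b _ _|V W oV oW u b ub [Vb Wb]|F FO u b ub [V FV Vb]].
  + exact: nearW.
  + by apply: filterI; [exact: oV ub Vb|exact: oW ub Wb].
  + by apply: filterS (FO _ FV _ _ ub Vb) => n Vn; exists V.
- by move=> u b ub V; apply.
- by move=> u b /alg_cvgP; exact: oU.
Qed.

Lemma seq_closed_closed (C : set (seq_space B)) : seq_closed C -> closed C.
Proof.
move=> sC; rewrite -openC open_seq_spaceE.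
apply: seq_open_tau_s => u b ub nCb; apply: contrapT => nC; apply: nCb.
by have [v Cv vb] := order_cvg_frequently ub nC; exact: sC vb.
Qed.

Lemma order_cvg_tau_s (u : nat -> seq_space B) (b : seq_space B) :
  order_cvg u b -> u @ \oo --> b.
Proof.
move=> /alg_cvgP ub U; rewrite nbhsE => -[V [oV Vb] VU].
have [_ /(_ _ _ ub V oV Vb) Vu _] := tau_s_largest B.
by move: Vu; apply: filterS => n; exact: VU.
Qed.

(** A sequence converging outside the union eventually leaves [Y] and each single [v i]. Its terms
    are then values of [v] at arbitrarily large indices, so its limit is that of a subsequence of
    [v], hence in [Y]. *)
Lemma seq_closed_range v (Y : set B) : seq_closed Y ->
  (forall (psi : nat -> nat) c, (forall n, (n <= psi n)%N) ->
     order_cvg (v \o psi) c -> Y c) ->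
  seq_closed (range v `|` Y)%classic.
Proof.
move=> sY vY w c wC wc; apply: contrapT => /not_orP[nvc nYc].
have nY : \forall n \near \oo, ~ Y (w n).
  by apply: contrapT => /(order_cvg_frequently wc)[t Yt /(sY _ _ Yt)].
have nv i : \forall n \near \oo, w n <> v i.
  apply: contrapT => /(@order_cvg_frequently (eq^~ (v i)) _ _ wc)[t tv tc].
  apply: nvc; exists i => //; apply: order_cvg_unique tc.
  by rewrite (_ : t = fun=> v i); [exact: order_cvg_cst|exact/funext].
have far N : \forall n \near \oo, forall i, (i < N)%N -> w n <> v i.
  elim: N => [|N IH]; first exact: nearW.
  apply: filterS2 IH (nv N) => n wn wN i; rewrite ltnS leq_eqVlt.
  by case/predU1P=> [->|] //; exact: wn.
have ex n : exists km : nat * nat,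
    [/\ (n <= km.1)%N, (n <= km.2)%N & w km.1 = v km.2].
  have [k [[nk nYk] wk]] :=
    filter_ex (filterI (filterI (nbhs_infty_ge n) nY) (far n)).
  have [[m _ vm]|//] := wC k; exists (k, m); split=> //=.
  by rewrite leqNgt; apply/negP => /wk; rewrite vm.
have [km kmP] := choice ex.
apply: nYc; apply: (vY (snd \o km)) => [n|]; first by have [] := kmP n.
have -> : v \o (snd \o km) = w \o (fst \o km).
  by apply/funext => n /=; have [_ _ ->] := kmP n.
by apply: order_cvg_subseq wc => n; have [] := kmP n.
Qed.

(* If no subsequence of [u] converges algebraically to [x], then, after passing
   to a subsequence avoiding [x], its range together with the at most one
   algebraic limit of its subsequences is a closed set missing [x]. *)
Lemma tau_s_cvg_subseq (u : nat -> seq_space B) (x : seq_space B) :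
  u @ \oo --> x ->
  exists2 phi : nat -> nat, (forall n, (n <= phi n)%N) & order_cvg (u \o phi) x.
Proof.
move=> ux; apply: contrapT => nx.
have nc phi : (forall n, (n <= phi n)%N) -> ~ order_cvg (u \o phi) x.
  by move=> phin c; apply: nx; exists phi.
have [N _ uN] : \forall n \near \oo, u n <> x.
  apply: contrapT => /not_near_infty[phi phiP].
  apply: (nc phi) => [n|]; first exact: (phiP n).1.
  rewrite (_ : u \o phi = fun=> x); first exact: order_cvg_cst.
  by apply/funext => n; apply: contrapT; exact: (phiP n).2.
suff [phi [Y [phin Yx sY]]] : exists phi : nat -> nat, exists Y : set B,
    [/\ forall n, (maxn n N <= phi n)%N, ~ Y x &
      seq_closed (range (u \o phi) `|` Y)%classic].
  have cC := @seq_closed_closed (range (u \o phi) `|` Y)%classic sY.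
  have [[n _ /= phix]|//] : (range (u \o phi) `|` Y)%classic x.
    apply: (@closed_cvg _ _ \oo _ (u \o phi) _ cC).
      by apply: nearW => n; left; exists n.
    apply: cvg_comp ux => P [K _ KP]; exists K => // n Kn; apply: KP => /=.
    by apply: leq_trans Kn _; apply: leq_trans (phin n); exact: leq_maxl.
  by apply: (uN (phi n)) phix => /=; apply: leq_trans (phin n); exact: leq_maxr.
(* If some subsequence has a limit [y], then [y] differs from [x] and [Y] is [[set y]]; otherwise
   [Y] is empty. Indices [maxn n N] skip the terms that may equal [x]. *)
have [[[phi y] [phin phiy]]|ny] := pselect (exists phi : (nat -> nat) * B,
    (forall n, (n <= phi.1 n)%N) /\ order_cvg (u \o phi.1) phi.2).
  pose psi n := phi (maxn n N).
  have psin n : (n <= psi n)%N.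
    by apply: leq_trans (phin _); exact: leq_maxl.
  have psiy : order_cvg (u \o psi) y.
    apply: (@order_cvg_subseq (u \o phi) y (maxn^~ N)) => // n.
    exact: leq_maxl.
  exists psi, [set y]; split=> [n|xy|].
  - exact: phin.
  - by apply: (nc psi) => //; rewrite xy.
  - apply: seq_closed_range => [w c wy wc|chi c chin /order_cvg_unique].
      apply: (order_cvg_unique wc).
      by rewrite (_ : w = fun=> y); [exact: order_cvg_cst|exact/funext].
    apply; exact: (@order_cvg_subseq (u \o psi)).
exists (maxn^~ N), set0; split=> //.
apply: seq_closed_range => [w c /(_ 0%N)//|].
move=> chi c chin uc; apply: ny; exists (maxn^~ N \o chi, c); split=> //= n.
by apply: leq_trans (chin n) _; exact: leq_maxl.
Qed.

(** * Diagonal properties and the Fréchet property *)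

Definition diagonal_property : Prop :=
  forall y : nat -> nat -> B, (forall n, down0 (y n)) ->
  exists (g : nat -> nat) (z : nat -> B),
    down0 z /\ forall n, y n (g n) <= z n.

(** Controlling all rows up to [n] at once lets a fixed row get below every [z K]. *)
Definition strong_diagonal_property : Prop :=
  forall y : nat -> nat -> B, (forall n, down0 (y n)) ->
  exists (g : nat -> nat) (z : nat -> B),
    down0 z /\ forall i n, (i <= n)%N -> y i (g n) <= z n.

(** The set [S] of order limits of sequences in [A] is closed: if [u n] in [S] tends to [b] and
    [v n] tends to [u n] with error [y n], the diagonal [v n (g n)] tends to [b]. *)
Lemma diagonal_frechet : diagonal_property -> frechet_space (seq_space B).
Proof.
move=> D A; apply/seteqP; split=> [x clA|x [u Au ux]]; last first.
  move=> U /ux[N _ UN]; exists (u N); split=> //; exact: UN (leqnn N).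
pose S : set (seq_space B) :=
  [set x | exists2 u : nat -> B, (forall n, A (u n)) & order_cvg u x].
suff [u Au ux] : S x by exists u => //; exact: order_cvg_tau_s.
have cS : closed S.
  apply: seq_closed_closed => u b Su [z dz ub].
  have /choice[v vP] n : exists v, (forall m, A (v m)) /\ order_cvg v (u n).
    by have [v] := Su n; exists v.
  have vA n m : A (v n m) by exact: (vP n).1.
  have /choice[y yP] n : exists y : nat -> B, down0 y /\ forall m,
      v n m <= u n `|` y m /\ u n <= v n m `|` y m.
    by have [_ [y dy yv]] := vP n; exists y.
  have [g [z' [dz' yz']]] := D y (fun n => (yP n).1).
  exists (fun n => v n (g n)) => //.
  exists (fun n => z n `|` z' n); first exact: down0_join.
  move=> n; have [vu uv] := (yP n).2 (g n); have [ubn bun] := ub n.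
  split.
    apply: le_trans vu _; rewrite joinA; exact: leU2.
  apply: le_trans bun _; rewrite [z n `|` _]joinC joinA; apply: leU2 => //.
  by apply: le_trans uv _; exact: leU2.
rewrite (closure_id S).1// in clA *.
apply: closureS clA => a Aa; exists (fun=> a) => //; exact: order_cvg_cst.
Qed.

(* The elements [y n0 n] added to the double sequence are nonzero and tend to
   [\bot]; they force the row index to infinity along any null sequence. *)
Lemma frechet_diagonal :
  frechet_space (seq_space B) -> strong_diagonal_property.
Proof.
move=> F y dy.
(* If every row reaches [\bot], a running maximum of the places where it does so suffices. *)
have [/choice[g0 g0P]|] := pselect (forall n, exists m, y n m = \bot).
  exists (fun n => \max_(i < n.+1) g0 i)%N, (fun=> \bot).
  split=> [|i n ni]; first exact: down0_cst0.
  rewrite -(g0P i); apply: down0_le => //.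
  by apply: (leq_bigmax (Ordinal (ni : (i < n.+1)%N))).
move=> /existsNP[n0 /forallNP e0].
pose Y n m := \join_(i < n.+1) y i m.
have dY n : down0 (Y n) by exact: down0_joins.
have yY i n m : (i <= n)%N -> y i m <= Y n m.
  by move=> ni; rewrite /Y (joins_sup (j := Ordinal (ni : (i < n.+1)%N))).
pose A : set (seq_space B) := [set x | exists n m, x = y n0 n `|` Y n m].
(* A neighbourhood of [\bot] contains some [y n0 N], and then, as [Y N] decreases to [\bot], some
   element of [A]. *)
have clA : closure A \bot.
  move=> U; rewrite nbhsE => -[V [oV V0] VU].
  have y0 : order_cvg (y n0) \bot.
    by exists (y n0) => // n; rewrite le0x join0x.
  have [_ seqV _] := tau_s_largest B.
  have [N _ /(_ N (leqnn N)) VN] := seqV _ _ ((alg_cvgP _ _).2 y0) V oV V0.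
  have yN : order_cvg (fun m => y n0 N `|` Y N m) (y n0 N).
    by exists (Y N) => // m; split=> //; rewrite -joinA leUl.
  have [M _ /(_ M (leqnn M)) VM] := seqV _ _ ((alg_cvgP _ _).2 yN) V oV VN.
  exists (y n0 N `|` Y N M); split; [by exists N, M|exact: VU].
move: clA; rewrite F => -[u Au /tau_s_cvg_subseq[phi phin [z dz uz]]].
have /choice[N /choice[M NM]] := fun k => Au (phi k).
have {}uz k : y n0 (N k) <= z k /\ Y (N k) (M k) <= z k.
  by have [+ _] := uz k; rewrite /= NM join0x leUx => /andP.
(* Were [N k] below [n] for all [k >= n], the nonzero [y n0 n] would lie below every [z k]. *)
have ex n : exists k, (n <= k)%N /\ (n <= N k)%N.
  apply: contrapT => nk; apply: (e0 n); apply: dz.2 => k.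
  apply: le_trans (down0_le dz (leq_maxl k n)).
  apply: le_trans (uz _).1; apply: down0_le => //.
  rewrite leqNgt; apply/negP => nN; apply: nk; exists (maxn k n).
  by rewrite leq_maxr ltnW.
have [ka kaP] := choice ex.
exists (M \o ka), z; split=> // i n ni /=.
apply: le_trans (yY _ (N (ka n)) _ _) _; first exact: leq_trans ni (kaP n).2.
by apply: le_trans (uz _).2 _; exact: down0_le (kaP n).1.
Qed.

(** * Tail joins of antichains: necessity of both conditions *)

Definition tail_join A (r : B -> nat) m :=
  bigjoin [set a | A a /\ (m <= r a)%N].

Lemma tail_join_disjoint A (r : B -> nat) m a : antichain A -> A a ->
  (r a < m)%N -> tail_join A r m `&` a = \bot.
Proof.
move=> [_ Ad] Aa ram; apply: bigjoin_disjoint => a' [Aa' mr].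
apply: Ad => //; apply: contraTneq mr => ->; by rewrite -ltnNge.
Qed.

(** A lower bound of all tails misses each [a] in [A], by the tail beyond [r a], yet lies below the
    join of [A]. *)
Lemma down0_tail_join A (r : B -> nat) : antichain A -> down0 (tail_join A r).
Proof.
move=> aA; split=> [m|c cm].
  by apply: bigjoin_le => a [Aa ma]; apply: bigjoin_ub; split=> //; exact: ltnW.
have : bigjoin [set a | A a /\ (0 <= r a)%N] `&` c = \bot.
  apply: bigjoin_disjoint => a [Aa _]; apply/eqP; rewrite -lex0.
  rewrite -(tail_join_disjoint aA Aa (ltnSn (r a))) meetC; exact: leI2.
by rewrite (meet_idPr (cm 0%N)).
Qed.

(** [Q] consists of the elements disjoint from some [z K]. Such an element misses all members of
    [P n] of rank at least [g (maxn n K)], and ranks are injective. *)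
Lemma diagonal_weakly_distributive :
  strong_diagonal_property -> weakly_distributive B.
Proof.
move=> D P PP.
have /choice[r rP] n : exists r : B -> nat, {in P n &, injective r}.
  exact/countable_injP/(PP n).2.
have aP n : antichain (P n) by have [[]] := PP n.
have [g [z [dz yz]]] :=
  D (fun n => tail_join (P n) (r n)) (fun n => down0_tail_join _ (aP n)).
exists [set q | exists K, q `&` z K = \bot] => [b b0|q [K qK] n].
  have [K bK] : exists K, ~~ (b <= z K).
    apply: contrapT => /forallNP nK; move/eqP: b0; apply.
    by apply: dz.2 => K; apply/negPn/negP; exact: nK.
  exists (b `\` z K); split; [by exists K; exact: diffIK| |exact: leBx].
  by rewrite diff_eq0.
apply: (@sub_finite_set _ _ (P n `&` r n @^-1` `I_(g (maxn n K)))%classic).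
  move=> p [Pp qp]; split=> //=; rewrite ltnNge; apply: contra qp => gp.
  rewrite -lex0 -qK; apply: leI2 => //.
  apply: le_trans (down0_le dz (leq_maxr n K)).
  by apply: le_trans (yz _ _ (leq_maxl n K)); exact: bigjoin_ub.
apply: card_le_finite (finite_II (g (maxn n K))).
rewrite -(card_le_eql (inj_card_eq (f := r n) _)).
  by apply: subset_card_le => _ [p [_ pg] <-].
by move=> p p' /set_mem[Pp _] /set_mem[Pp' _]; apply: rP; exact: mem_set.
Qed.

(** If [A] mapped onto an unbounded family by [f], ranking [a] by [f a n] in row [n] would give some
    [a] with [g n <= f a n], hence [a <= z n], for infinitely many [n], forcing [a] to be [\bot]. *)
Lemma diagonal_b_chain_condition :
  strong_diagonal_property -> b_chain_condition B.
Proof.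
move=> D A aA; have [F bF] := has_card_b_ex; exists F => //.
have [FA|nFA] := boolP (F #<= A); last first.
  by rewrite andbT; have [//|FA] := card_le_total A F; rewrite FA in nFA.
exfalso; have /pcard_surjP[f FfA] := FA.
have [g [z [dz yz]]] := D (fun n => tail_join A (fun a => f a n))
  (fun n => down0_tail_join _ aA).
have [uF _] := bF; have [_ /FfA[a Aa <-] fin] := uF g.
have [a0 _] := aA; move/eqP: (a0 a Aa); apply; apply: dz.2 => k.
apply: contrapT => ak; apply: fin.
apply: sub_finite_set (finite_II k) => n /= gn; rewrite ltnNge.
apply/negP => kn; apply: ak; apply: le_trans (down0_le dz kn).
by apply: le_trans (yz n n (leqnn n)); exact: bigjoin_ub.
Qed.

(** * Layers of decreasing sequences: sufficiency of both conditions *)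

Lemma maximal_antichain_in (Q : set B) : exists A, [/\ A `<=` Q, antichain A &
  forall q, Q q -> q != \bot -> exists2 a, A a & a `&` q != \bot].
Proof.
have [|A [[AQ [A0 Ad]] Amax]] :=
    @Zorn_bigcup _ [set A : set B | A `<=` Q /\ antichain A].
  move=> K KP Ktot; split=> [a [A KA Aa]|].
    exact: (KP _ KA).1.
  split=> [a [A KA Aa]|a b [A KA Aa] [A' KA' Ab]].
    exact: (KP _ KA).2.1.
  have [AA'|A'A] := Ktot _ _ KA KA'.
    by apply: (KP _ KA').2.2 => //; exact: AA'.
  by apply: (KP _ KA).2.2 => //; exact: A'A.
exists A; split=> // q Qq q0; apply: contrapT => nq.
have qA a : A a -> a `&` q = \bot.
  by move=> Aa; apply/eqP/negPn/negP => aq; apply: nq; exists a.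
apply: (Amax (A `|` [set q])%classic).
  split=> [a Aa|/(_ q)/(_ (or_intror erefl)) Aq]; first by left.
  by have := qA _ Aq; rewrite meetxx => /eqP; rewrite (negbTE q0).
split=> [a [/AQ//|->//]|]; split=> [a [/A0//|->//]|a b [Aa|->] [Ab|->]].
- exact: Ad.
- by rewrite qA.
- by rewrite meetC qA.
- by rewrite eqxx.
Qed.

(** Successive differences, with [\top] standing before [y 0]. *)
Definition layer (y : nat -> B) m := (if m is k.+1 then y k else \top) `\` y m.

Lemma layer_disjoint (y : nat -> B) i j : down0 y -> (i < j)%N ->
  layer y i `&` layer y j = \bot.
Proof.
case: j => [//|j] dy ij; apply/eqP; rewrite -lex0.
rewrite -(diffIK (if i is k.+1 then y k else \top) (y i)); apply: leI2 => //.
apply: le_trans (_ : y j <= _); last exact: down0_le.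
by rewrite /layer leBx.
Qed.

(** The layers up to [m] join to the complement of [y m]. *)
Lemma le_layer (y : nat -> B) c m : down0 y ->
  (forall i, (i <= m)%N -> c `&` layer y i = \bot) -> c <= y m.
Proof.
move=> dy; elim: m => [|m IH] cy.
  rewrite -diff_eq0 -(cy 0%N)// /layer meetxB meetx1; exact/eqP.
have cm : c <= y m by apply: IH => i im; apply: cy; exact: leqW.
by rewrite -diff_eq0 -(cy m.+1)// /layer meetxB (meet_idPl cm).
Qed.

Lemma maximal_antichain_layer (y : nat -> B) : down0 y ->
  maximal_antichain (range (layer y) `\ \bot)%classic.
Proof.
move=> dy; split.
  split=> [a [_ /eqP]//|_ _ [[i _ <-] _] [[j _ <-] _]].
  case: (ltngtP i j) => [ij _|ji _|->]; last by rewrite eqxx.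
  - exact: layer_disjoint.
  - by rewrite meetC layer_disjoint.
move=> A' [A'0 A'd] sub; apply/seteqP; split=> // a A'a.
apply: contrapT => na; move/eqP: (A'0 a A'a); apply; apply: dy.2 => m.
apply: le_layer => // i _; have [->|li0] := eqVneq (layer y i) \bot.
  exact: meetx0.
have Li : (range (layer y) `\ \bot)%classic (layer y i).
  by split; [exists i|exact/eqP].
apply: A'd => //; first exact: sub.
by apply/eqP => ali; apply: na; rewrite ali.
Qed.

Lemma finite_layer (y : nat -> B) q : down0 y ->
  finite_set [set p | (range (layer y) `\ \bot)%classic p /\ q `&` p != \bot] ->
  exists m, q `&` y m = \bot.
Proof.
move=> dy fin.
have /finite_set_nat_lt[M qM] : finite_set [set m | q `&` layer y m != \bot].
  apply: card_le_finite fin.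
  rewrite -(card_le_eql (inj_card_eq (f := layer y) _)).
    apply: subset_card_le => _ [m qm <-]; split=> //; split; first by exists m.
    by move=> l0; move: qm; rewrite /= l0 meetx0 eqxx.
  move=> i j /set_mem/= qi /set_mem/= qj lij; apply/eqP.
  have li : layer y i != \bot by apply: contraNneq qi => ->; rewrite meetx0.
  by apply: contraNT li; case: ltngtP => // ij _;
    rewrite -(layer_disjoint dy ij) lij meetxx.
(* [q] misses the layers after [M] by choice of [M], and [y M] misses those up to [M]. *)
exists M; apply: dy.2 => m; apply: le_layer => // i _; apply/eqP.
have [iM|Mi] := leqP i M; last first.
  rewrite -lex0; apply: le_trans (_ : q `&` layer y i <= _).
    by apply: leI2 => //; exact: leIl.
  by rewrite lex0; apply/negPn/negP => /qM; rewrite ltnNge ltnW.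
rewrite -lex0 -(diffKI (if i is k.+1 then y k else \top) (y i)).
apply: leI2 => //; apply: le_trans (leIr _ _) _; exact: down0_le.
Qed.

Lemma weakly_distributive_diagonal :
  weakly_distributive B -> b_chain_condition B -> diagonal_property.
Proof.
move=> wd bcc y dy.
have [|Q dQ Qfin] := wd (fun n => range (layer (y n)) `\ \bot)%classic.
  move=> n; split; first exact: maximal_antichain_layer.
  apply: sub_countable (subset_card_le (@subDsetl _ _ _)) _.
  exact: card_image_le.
have Qf q : Q q -> exists f : nat -> nat, forall n, q `&` y n (f n) = \bot.
  move=> Qq; have /choice[f fP] n : exists m, q `&` y n m = \bot.
    exact/finite_layer/Qfin.
  by exists f.
have [A [AQ aA Amax]] := maximal_antichain_in Q.
have [F [_ Fmin] /andP[_ nFA]] := bcc A aA.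
have /choice[f fP] q : exists f : nat -> nat,
    A q -> forall n, q `&` y n (f n) = \bot.
  have [/AQ/Qf[f fq]|nAq] := pselect (A q); first by exists f.
  by exists (fun=> 0%N).
(* Otherwise the functions [f q] with [q] in [A] form an unbounded family, and minimality of [F]
   gives [F #<= A]. *)
have [g gP] : exists g : nat -> nat, forall q, A q ->
    finite_set [set n | (g n <= f q n)%N].
  apply: contrapT => /forallNP ng; move/negP: nFA; apply.
  apply: card_le_trans (card_image_le f A); apply: Fmin => g.
  have /existsNP[q /not_implyP[Aq fin]] := ng g.
  by exists (f q) => //; exists q.
exists g, (fun k => bigjoin [set y n (g n) | n in [set n | (k <= n)%N]]).
split=> [|n]; last by apply: bigjoin_ub; exists n => /=.
split=> [k|c ck].
  by apply: bigjoin_le => _ [n /= kn <-]; apply: bigjoin_ub; exists n => //=;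
    exact: ltnW.
apply/eqP/negPn/negP => c0.
(* Some [a] in [A] meets [q], hence [c]; but [f a n < g n] for [n >= N], so [a] misses the tail join
   from [N], which is above [c]. *)
have [q [Qq q0 qc]] := dQ c c0; have [a Aa] := Amax q Qq q0.
have [N gN] := finite_set_nat_lt (gP a Aa).
rewrite -lex0; case/negP.
apply: le_trans (leI2 (lexx a) (le_trans qc (ck N))) _.
rewrite meetC bigjoin_disjoint// => _ [n /= Nn <-].
apply/eqP; rewrite -lex0 -(fP a Aa n) meetC; apply: leI2 => //.
apply: down0_le => //; rewrite leqNgt; apply/negP => /ltnW/gN.
by rewrite ltnNge Nn.
Qed.

End Convergence.

Theorem theorem3p4 (d : Order.disp_t) (B : ctbDistrLatticeType d)
  (hB : complete_boolean_algebra B) :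
  frechet_space (seq_space B) <-> weakly_distributive B /\ b_chain_condition B.
Proof.
split=> [F|[wd bcc]].
  have D := frechet_diagonal hB F.
  split; first exact: diagonal_weakly_distributive.
  exact: diagonal_b_chain_condition.
exact/(diagonal_frechet hB)/weakly_distributive_diagonal.
Qed.
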